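(* For each $n\ge1$, let $(c^n_k)_{k\ge1}$ be the unique solution to $(E_n)$ and let $(p^n_k)_{k\ge1}$ be the probability distribution defined by $p^n_k=c^n_k/m_0(c^n)$. Then $$\lim_{n\to\infty}\sum_{k\ge1}|p^n_k-p_k|=0,\qquad\text{where}\quad p_k:=\frac{2}{4^kk}\binom{2k-2}{k-1}.$$ The sequence $(p_k)_{k\ge1}$ is the unique nonnegative solution to $$\sum_{k\ge1}p_k=1,\qquad p_k=\frac12\sum_{i=1}^{k-1}p_ip_{k-i}\quad(k\ge2).$$ Moreover, as $k\to\infty$, $$p_k\sim\frac{1}{2\sqrt{\pi}\,k^{3/2}}.$$
   Context: For a $[0,\infty)$-valued sequence $u=(u_k)_{k\ge1}$ and $i\ge 0$, put $m_i(u)=\sum_{k\ge1}k^iu_k$. For $n\in\mathbb{N}=\{1,2,\dots\}$, a sequence $c^n=(c^n_k)_{k\ge1}$ of nonnegative real numbers is said to solve $(E_n)$ if $m_1(c^n)=1$ and, for all $k\ge2$, $\left(2+\frac{k-1}{n}\right)c^n_k=\frac{1}{m_0(c^n)}\sum_{i=1}^{k-1}c^n_ic^n_{k-i}$. It is known that $(E_n)$ has exactly one solution for each $n\in\mathbb{N}$. *)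

(* Defs.v *)
From mathcomp Require Import all_boot all_order all_algebra.
From mathcomp Require Import all_classical all_reals all_analysis.

Set Implicit Arguments.
Unset Strict Implicit.
Unset Printing Implicit Defensive.

Import Order.TTheory GRing.Theory Num.Theory.
Import numFieldNormedType.Exports.

Local Open Scope classical_set_scope.
Local Open Scope ring_scope.

(* Sequences (u_k)_{k >= 1} are functions nat -> R whose value at 0 is ignored:
   every sum and every condition below only involves indices k >= 1. *)

(* The moment m_i(u), with values in [0, +oo] when u is nonnegative. *)
Definition moment (R : realType) (i : nat) (u : nat -> R) : \bar R :=
  (\sum_(1 <= k <oo) (k%:R ^+ i * u k)%:E)%E.

(* [fine] only forgets that m_0(u) is an extended real: nonnegativity and
   m_1(u) = 1 force 0 < m_0(u) <= 1. *)
Definition solves_E (R : realType) (n : nat) (u : nat -> R) : Prop :=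
  [/\ (forall k, (1 <= k)%N -> 0 <= u k),
      moment 1 u = 1%E
    & forall k, (2 <= k)%N ->
        (2 + (k%:R - 1) / n%:R) * u k =
        (fine (moment 0 u))^-1 * \sum_(1 <= i < k) u i * u (k - i)%N].

Definition normalized (R : realType) (u : nat -> R) : nat -> R :=
  fun k => u k / fine (moment 0 u).

Definition plim (R : realType) (k : nat) : R :=
  2 / (4 ^+ k * k%:R) * 'C(2 * k - 2, k - 1)%:R.

Definition solves_limit_eq (R : realType) (q : nat -> R) : Prop :=
  [/\ (forall k, (1 <= k)%N -> 0 <= q k),
      (\sum_(1 <= k <oo) (q k)%:E = 1)%E
    & forall k, (2 <= k)%N ->
        q k = 1 / 2 * \sum_(1 <= i < k) q i * q (k - i)%N].

(* Main.v *)
(** The quadratic recursions [w k * u k = \sum_i u i * u (k - i)] obey a discrete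
    comparison principle, which replaces generating functions throughout.
    Comparing with [k |-> t ^+ k * plim k], which solves the limit recursion for
    every [t], gives uniqueness, since only [t = 1] has total mass 1; it also
    shows that the normalized solution [p] of (E_n) has [p 1 >= 1/2], since a
    smaller value would force the mass below 1.  Comparing in the other direction,
    [plim k <= L ^+ (k-1) * p k] for [k <= K] with [L = 1 + K / (2n)], and because
    both masses equal 1 this one-sided bound controls the l1 distance by
    [2 (L ^+ K - 1)] plus twice the tail of [plim] beyond [K].

    With [b k = 'C(2k, k) / 4^k] one has [plim (k+1) = b k - b (k+1)], so that tail
    is [b K], and the asymptotics of [plim] reduce to Wallis' bounds on [b]. *)

Require Import Defs.
From mathcomp Require Import all_boot all_order all_algebra.
From mathcomp Require Import all_classical all_reals all_analysis.
From mathcomp Require Import zify ring lra.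

Import Order.TTheory GRing.Theory Num.Theory.
Import numFieldNormedType.Exports.

Local Open Scope classical_set_scope.
Local Open Scope ring_scope.

(** * Comparison and symmetrization for discrete convolutions *)

(** The convolution at [k] only sees indices below [k] and is monotone on nonnegative entries, so
    strong induction applies. The cutoff [K] matters because the weights of (E_n) are uniformly
    close to 2 only on a bounded range. *)
Lemma conv_comparison (R : realFieldType) (w u v : nat -> R) (K : nat) :
  (forall k, (1 <= k)%N -> 0 <= u k) ->
  (forall k, (2 <= k <= K)%N -> 0 < w k) ->
  (forall k, (2 <= k <= K)%N ->
     w k * u k <= \sum_(1 <= i < k) u i * u (k - i)%N) ->
  (forall k, (2 <= k <= K)%N ->
     \sum_(1 <= i < k) v i * v (k - i)%N <= w k * v k) ->
  u 1%N <= v 1%N ->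
  forall k, (1 <= k <= K)%N -> u k <= v k.
Proof.
move=> u0 w0 usub vsup uv1; elim/ltn_ind => k IH /andP[k1 kK].
have [k2|] := leqP 2 k; last by move=> ?; have -> : k = 1%N by lia.
have kr : (2 <= k <= K)%N by rewrite k2.
rewrite -(ler_pM2l (w0 _ kr)) (le_trans (usub _ kr))// (le_trans _ (vsup _ kr))//.
apply: ler_sum_nat => i /andP[i1 ik].
by apply: ler_pM; [apply: u0; lia|apply: u0; lia|apply: IH; lia|apply: IH; lia].
Qed.

(** The products are invariant under [i -> k - i], so adding the reversed sum turns the weights into
    [i + (k - i) = k]. *)
Lemma sum_conv_weight (R : comRingType) (f : nat -> R) (k : nat) :
  (\sum_(1 <= i < k) i%:R * (f i * f (k - i)%N)) *+ 2 =
  k%:R * \sum_(1 <= i < k) f i * f (k - i)%N.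
Proof.
rewrite mulr2n {2}big_nat_rev -big_split mulr_sumr /=.
apply: eq_big_nat => i /andP[i1 ik].
have -> : (1 + k - i.+1 = k - i)%N by lia.
have -> : (k - (k - i) = i)%N by lia.
rewrite [f (k - i)%N * _]mulrC -mulrDl -natrD; congr (_%:R * _); lia.
Qed.

(** * Central binomial weights and the limit sequence *)

(** The coefficients of (1 - x)^(-1/2), also the return probabilities of the simple random walk at
    time [2 * k]. *)
Definition central_weight (R : realType) (k : nat) : R :=
  'C(2 * k, k)%:R / 4 ^+ k.

Lemma central_weight0 (R : realType) : central_weight R 0 = 1.
Proof. by rewrite /central_weight muln0 bin0 expr0 divr1. Qed.

Lemma central_weight_gt0 (R : realType) (k : nat) : 0 < central_weight R k.
Proof. by rewrite divr_gt0 ?exprn_gt0// ltr0n bin_gt0; lia. Qed.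

Lemma central_binS (k : nat) :
  (k.+1 * 'C(2 * k.+1, k.+1) = 2 * (2 * k + 1) * 'C(2 * k, k))%N.
Proof.
have := mul_bin_diag (2 * k.+1) k.
have := mul_bin_down (2 * k + 1) k.
have -> : ((2 * k + 1).-1 = 2 * k)%N by lia.
have -> : ((2 * k.+1).-1 = 2 * k + 1)%N by lia.
have -> : (2 * k + 1 - k = k.+1)%N by lia.
set a := 'C(_, _); set b := 'C(_, _); set c := 'C(_, _) => h1 h2.
by rewrite -h2 mulnAC -mulnA -mulnA h1 mulnC; lia.
Qed.

Lemma central_weightS (R : realType) (k : nat) :
  central_weight R k.+1 = central_weight R k * (2 * k%:R + 1) / (2 * k%:R + 2).
Proof.
have /(congr1 (fun n => n%:R : R)) := central_binS k.
rewrite !natrM natrD -addn1 natrD natrM addn1 /central_weight exprS => h.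
have k0 : 0 <= k%:R :> R by [].
have f0 : 4 ^+ k != 0 :> R by rewrite expf_neq0// pnatr_eq0.
have k1 : k%:R + 1 != 0 :> R by rewrite gt_eqF//; lra.
apply: (mulfI k1); rewrite mulrA h; field.
by rewrite f0 /= gt_eqF//; lra.
Qed.

Lemma plimS (R : realType) (k : nat) :
  plim R k.+1 = central_weight R k / (2 * k%:R + 2).
Proof.
rewrite /plim /central_weight.
have -> : (2 * k.+1 - 2 = 2 * k)%N by lia.
have -> : (k.+1 - 1 = k)%N by lia.
have k0 : 0 <= k%:R :> R by [].
have f0 : 4 ^+ k != 0 :> R by rewrite expf_neq0// pnatr_eq0.
rewrite exprS -natr1; field.
by rewrite f0 /=; apply/andP; split; rewrite gt_eqF//; lra.
Qed.

Lemma plim_gt0 (R : realType) (k : nat) : (1 <= k)%N -> 0 < plim R k.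
Proof.
by case: k => // k _; rewrite plimS divr_gt0 ?central_weight_gt0.
Qed.

Lemma plim1 (R : realType) : plim R 1 = 1 / 2.
Proof. by rewrite plimS central_weight0 mulr0 add0r. Qed.

Lemma plim_rec (R : realType) (k : nat) : (1 <= k)%N ->
  2 * k.+1%:R * plim R k.+1 = (2 * k%:R - 1) * plim R k.
Proof.
case: k => // k _; rewrite !plimS central_weightS -!natr1.
have k0 : 0 <= k%:R :> R by [].
by field; rewrite !gt_eqF//; lra.
Qed.

(** Both sides satisfy the same first-order recurrence: weight the sum at [k+1]
    by [i], symmetrize ([sum_conv_weight]) and apply [plim_rec] termwise. *)
Lemma plim_conv (R : realType) (k : nat) : (2 <= k)%N ->
  \sum_(1 <= i < k) plim R i * plim R (k - i)%N = 2 * plim R k.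
Proof.
case: k => // k; rewrite ltnS; elim: k => // k IH _.
have [->|k0] := posnP k.
  rewrite big_nat1 /= subn1 /= plim1.
  by have := plim_rec R 1 isT; rewrite plim1; lra.
have {IH}Tk := IH k0.
have /(congr1 (fun x => 2 * x)) := sum_conv_weight R (plim R) k.+2.
set T := \sum_(1 <= i < k.+2) plim R i * plim R (k.+2 - i)%N.
have := sum_conv_weight R (plim R) k.+1; rewrite Tk.
(* Isolating [i = 1] and shifting the rest leaves the weights [i.+1] in [B]; [plim_rec] then
   expresses [B] through the weighted sum [A] one level down. *)
rewrite (big_ltn (n := k.+2))//= plim1 subSS subn0 mul1r.
rewrite (big_add1 _ _ 1) /=.
set A := \sum_(1 <= i < k.+1) _; set B := \sum_(1 <= i < k.+1) _ => hA hB.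
have : 2 * B = 2 * A - 2 * plim R k.+1.
  rewrite -Tk !mulr_sumr -sumrB; apply: eq_big_nat => i /andP[i1 ik].
  rewrite subSS.
  transitivity (2 * i.+1%:R * plim R i.+1 * plim R (k.+1 - i)%N); first by ring.
  by rewrite plim_rec//; ring.
have := plim_rec R k.+1 isT.
move: hA hB; rewrite -(natr1 k.+1) -(natr1 k) => hA hB h1 h2.
have k2 : (k%:R + 1 + 1 : R) != 0 by rewrite gt_eqF//; have : 0 <= k%:R :> R by []; lra.
apply: (mulfI k2); lra.
Qed.

Lemma sum_plim (R : realType) (K : nat) :
  \sum_(1 <= k < K.+1) plim R k = 1 - central_weight R K.
Proof.
elim: K => [|K IH]; first by rewrite big_geq// central_weight0 subrr.
rewrite big_nat_recr//= IH plimS central_weightS.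
by have : 0 <= K%:R :> R by []; move=> k0; field; rewrite gt_eqF//; lra.
Qed.

(** * Wallis' bounds on the central weights *)

(** The recursion is integration by parts, so that Wallis' bounds follow from
    derivatives alone, without any integral. *)
Fixpoint sin_prim (R : realType) (n : nat) (x : R) : R :=
  match n with
  | 0%N => x
  | 1%N => - cos x
  | m.+2 => (m.+1%:R * sin_prim R m x - cos x * sin x ^+ m.+1) / m.+2%:R
  end.

Lemma is_derive_sin_prim (R : realType) (n : nat) (x : R) :
  is_derive x 1 (sin_prim R n) (sin x ^+ n).
Proof.
elim/ltn_ind: n => -[|[|n]] IH.
- by rewrite expr0; exact: is_derive_id.
- by apply: is_derive_eq; rewrite opprK expr1.
have IHn : is_derive x 1 (sin_prim R n) (sin x ^+ n) by exact: IH.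
rewrite (_ : sin_prim R n.+2 = n.+2%:R^-1 \*: (n.+1%:R \*: sin_prim R n -
   cos * sin ^+ n.+1)); last first.
  apply/funext => y; rewrite /= mulrC; congr (_ * (_ - _ * _)).
  by rewrite fctE.
apply: is_derive_eq.
rewrite /GRing.scale /= fctE.
have n2 : n%:R + 1 + 1 != 0 :> R by rewrite gt_eqF//; have : 0 <= n%:R :> R by []; lra.
have h : cos x ^+ 2 = 1 - sin x ^+ 2 by rewrite -(cos2Dsin2 x) addrK.
rewrite !exprS -!natr1; field: h.
exact: n2.
Qed.

(** The Wallis integral of [sin ^+ n] over [0, pi/2], as an increment of its primitive. *)
Definition wallis_int (R : realType) (n : nat) : R :=
  sin_prim R n (pi / 2) - sin_prim R n 0.

(** The boundary term [cos x * sin x ^+ n.+1] vanishes at both endpoints. *)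
Lemma wallis_intSS (R : realType) (n : nat) :
  wallis_int R n.+2 = n.+1%:R / n.+2%:R * wallis_int R n.
Proof.
by rewrite /wallis_int /= cos_pihalf sin0 expr0n !mul0r mulr0 !subr0; ring.
Qed.

(** The difference of the primitives has derivative [sin x ^+ n * (1 - sin x)], nonnegative between
    0 and pi/2. *)
Lemma wallis_int_le (R : realType) (n : nat) :
  wallis_int R n.+1 <= wallis_int R n.
Proof.
have D (x : R) : is_derive x 1 (sin_prim R n - sin_prim R n.+1)
    (sin x ^+ n - sin x ^+ n.+1).
  by apply: is_deriveB; exact: is_derive_sin_prim.
have [h0 h2] : 0 < pi / 2 :> R /\ pi / 2 < 2 :> R by apply/andP/pihalf_02.
suff : (sin_prim R n - sin_prim R n.+1) 0 <=
       (sin_prim R n - sin_prim R n.+1) (pi / 2).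
  by rewrite !fctE /wallis_int; lra.
apply: (@ger0_derive1_ndecr _ _ 0 (pi / 2)) => //; last 2 first.
- apply: continuous_subspaceT => x.
  by apply: differentiable_continuous; exact/derivable1_diffP.
- exact: ltW.
move=> x; rewrite in_itv /= => /andP[x0 x1].
rewrite derive1E derive_val exprS -[X in X - _]mul1r -mulrBl.
rewrite mulr_ge0 ?subr_ge0 ?sin_le1// exprn_ge0//.
by rewrite ltW// sin_gt0_pihalf// x0.
Qed.

Lemma wallis_int_even (R : realType) (k : nat) :
  wallis_int R (2 * k) = central_weight R k * (pi / 2).
Proof.
elim: k => [|k IH]; first by rewrite muln0 central_weight0 mul1r /wallis_int subr0.
have -> : (2 * k.+1 = (2 * k).+2)%N by lia.
rewrite wallis_intSS IH central_weightS -!natr1 natrM.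
by have : 0 <= k%:R :> R by []; move=> k0; field; rewrite gt_eqF//; lra.
Qed.

Lemma wallis_int_odd (R : realType) (k : nat) :
  wallis_int R (2 * k).+1 = ((2 * k%:R + 1) * central_weight R k)^-1.
Proof.
elim: k => [|k IH].
  rewrite muln0 central_weight0 /wallis_int /= cos_pihalf cos0.
  by rewrite mulr0 add0r mulr1 invr1; lra.
have -> : (2 * k.+1 = (2 * k).+2)%N by lia.
rewrite wallis_intSS IH central_weightS -!natr1 natrM.
have c0 : central_weight R k != 0 by rewrite gt_eqF ?central_weight_gt0.
have : 0 <= k%:R :> R by []; move=> k0; field.
by rewrite c0 !gt_eqF//; lra.
Qed.

(** The Wallis integral of index [2 * k] lies between its two odd neighbours. It is proportional to
    the central weight and they to its inverse, which traps the square. *)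
Lemma central_weight_sqr_bounds (R : realType) (k : nat) : (1 <= k)%N ->
  2 * k%:R / (2 * k%:R + 1) <= (central_weight R k) ^+ 2 * (pi * k%:R) <= 1.
Proof.
case: k => // k _; set c := central_weight R k.+1.
have c0 : 0 < c by exact: central_weight_gt0.
have k0 : 0 <= k%:R :> R by [].
have w1 := wallis_int_le R (2 * k.+1).
have w2 := wallis_int_le R (2 * k).+1.
have e : ((2 * k).+2 = 2 * k.+1)%N by lia.
move: w1 w2; rewrite e wallis_int_even !wallis_int_odd -/c.
(* The lower odd neighbour involves the previous central weight; the ratio rewrites it in terms of
   [c]. *)
have -> : (2 * k%:R + 1) * central_weight R k = 2 * (k%:R + 1) * c.
  by rewrite /c central_weightS; field; rewrite gt_eqF//; lra.
rewrite -(natr1 k); set x : R := k%:R + 1; have x0 : 0 < x by rewrite /x; lra.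
move=> w1 w2; apply/andP; split.
- rewrite ler_pdivrMr; last by lra.
  move: w1; rewrite -[X in X <= _]mul1r ler_pdivrMr; last by rewrite mulr_gt0//; lra.
  by move=> h; have := ler_wpM2l (ltW x0) h; lra.
- have p : 0 < 2 * x * c by rewrite mulr_gt0//; lra.
  by move: w2; rewrite -(ler_pM2r p) mulVf ?gt_eqF//; lra.
Qed.

Lemma central_weight_cvg0 (R : realType) :
  central_weight R k @[k --> \oo] --> (0 : R).
Proof.
apply/cvgrPdist_le => e e0; near=> k.
have ck := central_weight_gt0 R k.
have k0 : (1 <= k)%N by near: k; exact: nbhs_infty_ge.
have kr : 0 < k%:R :> R by rewrite ltr0n.
have ke : (e ^+ 2)^-1 <= k%:R by near: k; exact: nbhs_infty_ger.
rewrite sub0r normrN ger0_norm ?(ltW ck)// -(@ler_pXn2r _ 2)//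
  ?nnegrE ?(ltW ck) ?(ltW e0)//.
have /andP[_ h] := central_weight_sqr_bounds R k k0.
have e2 : 0 < e ^+ 2 by rewrite exprn_gt0.
move: ke; rewrite -(ler_pM2l e2) mulfV ?gt_eqF// => ke.
rewrite -(ler_pM2r kr) (le_trans _ ke)// (le_trans _ h)//.
rewrite ler_pM2l ?exprn_gt0// -[leLHS]mul1r ler_pM2r//.
by have := pi_ge2 R; lra.
Unshelve. all: by end_near. Qed.

(** * Nonnegative series and the mass of [plim] *)

Lemma sum_le_nneseries (R : realType) (u : nat -> R) (s : R) (K : nat) :
  (forall k, (1 <= k)%N -> 0 <= u k) ->
  (\sum_(1 <= k <oo) (u k)%:E = s%:E)%E -> \sum_(1 <= k < K) u k <= s.
Proof.
move=> u0 us; rewrite -lee_fin -us -sumEFin.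
by apply: nneseries_lim_ge => k k1 _; rewrite lee_fin u0.
Qed.

(** The threshold [N] lets the l1 estimate consider only partial sums that contain the whole head up
    to its cutoff. *)
Lemma nneseries_le_bound (R : realType) (u : nat -> R) (s : R) (N : nat) :
  (forall k, (1 <= k)%N -> 0 <= u k) ->
  (forall K, (N <= K)%N -> \sum_(1 <= k < K.+1) u k <= s) ->
  (\sum_(1 <= k <oo) (u k)%:E <= s%:E)%E.
Proof.
move=> u0 us; apply: lime_le.
  by apply: is_cvg_nneseries => k k1 _; rewrite lee_fin u0.
near=> K; have K1 : (N.+1 <= K)%N by near: K; exact: nbhs_infty_ge.
by rewrite sumEFin lee_fin -(prednK (leq_trans (ltn0Sn N) K1)) us//; lia.
Unshelve. all: by end_near. Qed.

Lemma nneseries_plim (R : realType) : (\sum_(1 <= k <oo) (plim R k)%:E = 1)%E.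
Proof.
apply/cvg_lim => //; rewrite -cvg_shiftS /=.
under eq_fun do rewrite sumEFin sum_plim.
apply: cvg_EFin; first exact: nearW.
rewrite -[X in _ --> X]subr0; apply: cvgB; first exact: cvg_cst.
exact: central_weight_cvg0.
Qed.

Lemma solves_limit_eq_plim (R : realType) : solves_limit_eq (plim R).
Proof.
split; [by move=> k /(plim_gt0 R)/ltW|exact: nneseries_plim|].
by move=> k k2; rewrite plim_conv// mulrA mul1r mulVf ?mul1r// pnatr_eq0.
Qed.

(** * Uniqueness for the limit equation *)

(** Geometric rescaling preserves the limit recursion, which leaves the first term free to be
    matched. *)
Lemma conv_scale (R : comRingType) (u : nat -> R) (t : R) (k : nat) :
  \sum_(1 <= i < k) (t ^+ i * u i) * (t ^+ (k - i) * u (k - i)%N) =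
  t ^+ k * \sum_(1 <= i < k) u i * u (k - i)%N.
Proof.
rewrite mulr_sumr; apply: eq_big_nat => i /andP[i1 ik].
have -> : t ^+ k = t ^+ i * t ^+ (k - i) by rewrite -exprD subnKC// ltnW.
by ring.
Qed.

(** As [plim R 1 = 1 / 2], the scale [2 * u 1] makes the first terms agree. *)
Lemma subsolution_le_plim (R : realType) (u : nat -> R) :
  (forall k, (1 <= k)%N -> 0 <= u k) ->
  (forall k, (2 <= k)%N -> 2 * u k <= \sum_(1 <= i < k) u i * u (k - i)%N) ->
  forall k, (1 <= k)%N -> u k <= (2 * u 1%N) ^+ k * plim R k.
Proof.
move=> u0 usub k k1; set t := 2 * u 1%N.
apply: (@conv_comparison R (cst 2) u (fun k => t ^+ k * plim R k) k) => //.
- by move=> j /andP[j2 _]; exact: usub.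
- by move=> j /andP[j2 _]; rewrite conv_scale plim_conv//= mulrCA.
- by rewrite plim1 expr1 /t; lra.
- by rewrite k1 leqnn.
Qed.

(** If [t < 1], then [t ^+ k <= t] and the mass would be at most [t]. The inequality form covers
    both the limit equation and (E_n), whose weights are at least 2. *)
Lemma subsolution_first_ge (R : realType) (u : nat -> R) :
  (forall k, (1 <= k)%N -> 0 <= u k) ->
  (\sum_(1 <= k <oo) (u k)%:E = 1)%E ->
  (forall k, (2 <= k)%N -> 2 * u k <= \sum_(1 <= i < k) u i * u (k - i)%N) ->
  1 / 2 <= u 1%N.
Proof.
move=> u0 u1 usub; set t := 2 * u 1%N.
have t0 : 0 <= t by rewrite mulr_ge0// u0.
rewrite leNgt; apply/negP => ut.
have t1 : t < 1 by rewrite /t; lra.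
have : (\sum_(1 <= k <oo) (u k)%:E <= t%:E)%E.
  apply: (@nneseries_le_bound R u t 0) => // K _.
  have pK : \sum_(1 <= k < K.+1) plim R k <= 1.
    by rewrite sum_plim gerBl ltW// central_weight_gt0.
  rewrite -[leRHS]mulr1 (le_trans _ (ler_wpM2l t0 pK))// mulr_sumr.
  apply: ler_sum_nat => k /andP[k1 _].
  rewrite (le_trans (subsolution_le_plim _ _ u0 usub k k1))//.
  rewrite ler_pM2r ?plim_gt0// -/t -(prednK k1) exprS ler_piMr// exprn_ile1//.
  exact: ltW.
by rewrite u1 lee_fin leNgt t1.
Qed.

Lemma solves_limit_eq_unique (R : realType) (q : nat -> R) :
  solves_limit_eq q -> forall k, (1 <= k)%N -> q k = plim R k.
Proof.
move=> [q0 q1 qE]; set t := 2 * q 1%N.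
have qE2 k : (2 <= k)%N -> 2 * q k = \sum_(1 <= i < k) q i * q (k - i)%N.
  by move=> k2; rewrite qE// mulrA mulrCA divff ?mulr1 ?mul1r// pnatr_eq0.
have qsub k : (2 <= k)%N -> 2 * q k <= \sum_(1 <= i < k) q i * q (k - i)%N.
  by move=> k2; rewrite qE2.
have t1 : 1 <= t by have := subsolution_first_ge _ q q0 q1 qsub; rewrite /t; lra.
have t0 : 0 < t by rewrite (lt_le_trans _ t1).
have ple k : (1 <= k)%N -> t ^+ k * plim R k <= q k.
  move=> k1; apply: (@conv_comparison R (cst 2) (fun k => t ^+ k * plim R k) q k) => //.
  - by move=> j j1; rewrite mulr_ge0 ?exprn_ge0 ?ltW// plim_gt0.
  - by move=> j /andP[j2 _]; rewrite conv_scale plim_conv//= mulrCA.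
  - by move=> j /andP[j2 _]; rewrite qE2.
  - by rewrite plim1 expr1 /t; lra.
  - by rewrite k1 leqnn.
(* Since [t <= t ^+ k], [ple] bounds [t] times the mass of [plim] by that of [q]; both masses being
   1, [t <= 1]. *)
have : (\sum_(1 <= k <oo) (plim R k)%:E <= (t^-1)%:E)%E.
  apply: (@nneseries_le_bound R _ _ 0) => [k /(plim_gt0 R)/ltW //|K _].
  rewrite -[leRHS]mul1r ler_pdivlMr// mulr_suml.
  rewrite (le_trans _ (sum_le_nneseries R q 1 K.+1 q0 q1))//.
  apply: ler_sum_nat => k /andP[k1 _]; rewrite (le_trans _ (ple k k1))// mulrC.
  by rewrite ler_pM2r ?plim_gt0// -(prednK k1) exprS ler_peMr ?(ltW t0)// exprn_ege1.
rewrite nneseries_plim lee_fin invf_ge1// => t1'.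
have te : t = 1 by apply/eqP; rewrite eq_le t1 t1'.
move=> k k1; apply/eqP; rewrite eq_le; apply/andP; split.
- by have := subsolution_le_plim _ _ q0 qsub k k1; rewrite -/t te expr1n mul1r.
- by have := ple k k1; rewrite te expr1n mul1r.
Qed.

(** * The l1 estimate for normalized solutions *)

Lemma nneseriesZl_ge1 (R : realType) (u : nat -> R) (a : R) :
  (forall k, (1 <= k)%N -> 0 <= u k) ->
  (\sum_(1 <= k <oo) (a * u k)%:E = a%:E * \sum_(1 <= k <oo) (u k)%:E)%E.
Proof.
move=> u0; rewrite -limeMl//; last first.
  by apply: is_cvg_nneseries => k k1 _; rewrite lee_fin u0.
by apply/congr_lim/funext => n /=; rewrite !sumEFin -EFinM mulr_sumr.
Qed.

(** Dividing by [m_0] absorbs the factor [1 / m_0] of (E_n). This is legitimate since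
    [m_0 <= m_1 = 1], while [m_0 = 0] would make every [c k], hence [m_1], vanish. *)
Lemma normalized_spec (R : realType) (n : nat) (c : nat -> R) :
  solves_E n c ->
  [/\ (forall k, (1 <= k)%N -> 0 <= normalized c k),
      (\sum_(1 <= k <oo) (normalized c k)%:E = 1)%E
    & forall k, (2 <= k)%N -> (2 + (k%:R - 1) / n%:R) * normalized c k =
        \sum_(1 <= i < k) normalized c i * normalized c (k - i)%N].
Proof.
move=> [c0 c1 cE].
have m0E : moment 0 c = (\sum_(1 <= k <oo) (c k)%:E)%E.
  by apply: eq_eseriesr => k _; rewrite expr0 mul1r.
have m0_ge0 : (0 <= moment 0 c)%E.
  by rewrite m0E; apply: nneseries_ge0 => k k1 _; rewrite lee_fin c0.
have m0_le1 : (moment 0 c <= 1)%E.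
  rewrite m0E; apply: (@nneseries_le_bound R c 1 0) => // K _.
  have kc0 k : (1 <= k)%N -> 0 <= k%:R ^+ 1 * c k by move=> k1; rewrite mulr_ge0 ?c0.
  rewrite (le_trans _ (sum_le_nneseries R _ 1 K.+1 kc0 c1))//.
  apply: ler_sum_nat => k /andP[k1 _].
  by rewrite expr1 ler_peMl ?c0// ler1n.
have m0_fin : moment 0 c \is a fin_num.
  by rewrite ge0_fin_numE// (le_lt_trans m0_le1)// ltry.
set m := fine (moment 0 c); have mE : moment 0 c = m%:E by rewrite fineK.
have m_gt0 : 0 < m.
  rewrite lt_neqAle -lee_fin -mE m0_ge0 andbT eq_sym; apply/eqP => m00.
  have ck0 k : (1 <= k)%N -> c k = 0.
    move=> k1; apply/eqP; rewrite eq_le c0// andbT -m00.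
    have := sum_le_nneseries R c m k.+1 c0; rewrite -mE m0E => /(_ erefl).
    rewrite big_nat_recr//=; apply: le_trans; rewrite lerDr.
    by rewrite big_nat sumr_ge0// => i /andP[i1 _]; exact: c0.
  move: c1; rewrite /moment eseries0 => [/eqP|k k1 _].
    by rewrite eqe eq_sym oner_eq0.
  by rewrite ck0// mulr0.
split.
- by move=> k k1; rewrite divr_ge0 ?c0// ltW.
- under eq_eseriesr do rewrite /normalized -/m mulrC.
  rewrite nneseriesZl_ge1 ?invr_ge0 ?ltW// -m0E mE -EFinM mulVf//.
  by rewrite gt_eqF.
- move=> k k2; rewrite /normalized -/m mulrA cE// -/m mulrAC mulr_sumr.
  by apply: eq_bigr => i _; field; rewrite gt_eqF.
Qed.

Lemma conv_solution_l1_le (R : realType) (n K : nat) (p : nat -> R) :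
  (1 <= n)%N ->
  (forall k, (1 <= k)%N -> 0 <= p k) ->
  (\sum_(1 <= k <oo) (p k)%:E = 1)%E ->
  (forall k, (2 <= k)%N -> (2 + (k%:R - 1) / n%:R) * p k =
        \sum_(1 <= i < k) p i * p (k - i)%N) ->
  (\sum_(1 <= k <oo) `|p k - plim R k|%:E <=
   (2 * ((1 + K%:R / (2 * n%:R)) ^+ K - 1) + 2 * central_weight R K)%:E)%E.
Proof.
move=> n1 p0 p1 pE; set L := 1 + K%:R / (2 * n%:R).
have n0 : 0 < n%:R :> R by rewrite ltr0n.
have L1 : 1 <= L by rewrite lerDl divr_ge0// mulr_ge0// ltW.
have drift k : (1 <= k)%N -> 0 <= (k%:R - 1) / n%:R :> R.
  by move=> k1; rewrite divr_ge0 ?(ltW n0)// subr_ge0 ler1n.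
(* Base case of the comparison below, as [plim R 1 = 1 / 2]. *)
have first_ge : 1 / 2 <= p 1%N.
  apply: subsolution_first_ge => // k k2; rewrite -pE//.
  by rewrite ler_wpM2r ?p0 ?lerDl ?drift// ltnW.
(* With exponent [k.-1] the convolution carries only [k.-2] factors [L]; the spare one absorbs the
   weight, as [2 + (k - 1) / n <= 2 * L] for [k <= K]. *)
have plim_le k : (1 <= k <= K)%N -> plim R k <= L ^+ k.-1 * p k.
  apply: (@conv_comparison R (cst 2) (plim R) (fun k => L ^+ k.-1 * p k)) => //.
  - by move=> j /(plim_gt0 R)/ltW.
  - by move=> j /andP[j2 _]; rewrite plim_conv.
  - move=> j /andP[j2 jK].
    have -> : \sum_(1 <= i < j) L ^+ i.-1 * p i * (L ^+ (j - i).-1 * p (j - i)%N)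
        = L ^+ j.-2 * ((2 + (j%:R - 1) / n%:R) * p j).
      rewrite pE// mulr_sumr; apply: eq_big_nat => i /andP[i1 ij].
      have -> : (j.-2 = i.-1 + (j - i).-1)%N by lia.
      by rewrite exprD; ring.
    have -> : (j.-1 = j.-2.+1)%N by lia.
    rewrite exprS /=.
    rewrite [leRHS](_ : _ = L ^+ j.-2 * (2 * L * p j)); last by ring.
    rewrite ler_wpM2l ?exprn_ge0 ?(le_trans ler01)// ler_wpM2r ?p0 ?(ltnW j2)//.
    rewrite /L mulrDr mulr1 lerD2l.
    rewrite (_ : 2 * (K%:R / (2 * n%:R)) = K%:R / n%:R); last first.
      by field; rewrite gt_eqF.
    rewrite ler_pM2r ?invr_gt0// lerBlDr natr1 ler_nat; lia.
  - by rewrite plim1 expr0 [leRHS]mul1r.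
have LK1 : 1 <= L ^+ K by rewrite exprn_ege1.
(* An absolute value is the number plus twice its negative part, bounded here by
   [(L ^+ K - 1) * p k] and in the tail by [plim R k]. *)
have head_le k : (1 <= k <= K)%N ->
    `|p k - plim R k| <= p k - plim R k + 2 * (L ^+ K - 1) * p k.
  move=> /[dup] kK /plim_le h; have /andP[k1 kK'] := kK.
  have h' : L ^+ k.-1 * p k <= L ^+ K * p k.
    by rewrite ler_wpM2r ?p0// ler_weXn2l//; lia.
  have h2 : 0 <= (L ^+ K - 1) * p k by rewrite mulr_ge0 ?p0// subr_ge0.
  by rewrite ler_norml; apply/andP; split; lra.
have tail_le k : (1 <= k)%N ->
    `|p k - plim R k| <= p k - plim R k + 2 * plim R k.
  move=> k1; have := p0 k k1; have := plim_gt0 R k k1.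
  by move=> ? ?; rewrite ler_norml; apply/andP; split; lra.
apply: (@nneseries_le_bound R (fun k => `|p k - plim R k|) _ K) => // N KN.
have sp M : \sum_(1 <= k < M) p k <= 1 by exact: sum_le_nneseries.
have split_sum (f : nat -> R) : \sum_(1 <= k < N.+1) f k =
    \sum_(1 <= k < K.+1) f k + \sum_(K.+1 <= k < N.+1) f k.
  by rewrite -big_cat_nat.
have hh : \sum_(1 <= k < K.+1) `|p k - plim R k| <=
    \sum_(1 <= k < K.+1) p k - \sum_(1 <= k < K.+1) plim R k +
    2 * (L ^+ K - 1) * \sum_(1 <= k < K.+1) p k.
  rewrite mulr_sumr -sumrB -big_split.
  by apply: ler_sum_nat => k /andP[k1 kK]; apply: head_le; rewrite k1.
have ht : \sum_(K.+1 <= k < N.+1) `|p k - plim R k| <=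
    \sum_(K.+1 <= k < N.+1) p k - \sum_(K.+1 <= k < N.+1) plim R k +
    2 * \sum_(K.+1 <= k < N.+1) plim R k.
  rewrite mulr_sumr -sumrB -big_split.
  by apply: ler_sum_nat => k /andP[k1 kK]; apply: tail_le; lia.
(* The signed differences add up to at most [central_weight R N]; the tail of [plim] between [K] and
   [N] is [central_weight R K - central_weight R N]. *)
have := sp N.+1; have := sum_plim R N; have := sum_plim R K.
rewrite !split_sum => sK sN spN; have cN := central_weight_gt0 R N.
have := ler_wpM2l (_ : 0 <= 2 * (L ^+ K - 1)) (sp K.+1).
rewrite mulr_ge0 ?subr_ge0// => /(_ isT); lra.
Qed.

(** * Asymptotics of [plim] *)

(** The ratio equals [s * (2 * k) / (2 * k - 1)] with [s] the central weight times [sqrt (pi * k)],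
    and Wallis' bounds control [s]. *)
Lemma plim_equiv_ratio (R : realType) (k : nat) : (1 <= k)%N ->
  1 <= plim R k * (2 * Num.sqrt pi * (k%:R `^ (3 / 2))) <= 1 + (2 * k%:R - 1)^-1.
Proof.
move=> k1; have kr : 1 <= k%:R :> R by rewrite ler1n.
have k0 : 0 < k%:R :> R by lra.
have ck := central_weight_gt0 R k.
have pi0 := pi_gt0 R.
have plimE : plim R k = central_weight R k / (2 * k%:R - 1).
  case: k k1 kr k0 ck => // k _ kr k0 _; rewrite plimS central_weightS.
  rewrite -(natr1 k) in kr k0 *.
  by field; rewrite !gt_eqF//; lra.
set s := central_weight R k * Num.sqrt (pi * k%:R).
have s0 : 0 <= s by rewrite mulr_ge0 ?sqrtr_ge0// ltW.
have s2 : s ^+ 2 = central_weight R k ^+ 2 * (pi * k%:R).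
  by rewrite exprMn sqr_sqrtr// mulr_ge0// ltW.
have /andP[] := central_weight_sqr_bounds R k k1; rewrite -s2 => slo shi.
have s1 : s <= 1 by rewrite -(@ler_pXn2r _ 2)// ?nnegrE// expr1n.
(* As [0 <= s <= 1], [s ^+ 2 <= s]: the lower bound on the square passes to [s] without a root. *)
have slo' : 2 * k%:R / (2 * k%:R + 1) <= s.
  by rewrite (le_trans slo)// expr2 ler_piMr.
have -> : k%:R `^ (3 / 2) = k%:R * Num.sqrt k%:R :> R.
  rewrite (_ : 3 / 2 = 1 + 2^-1); last by lra.
  by rewrite powRD ?gt_eqF ?implybT// powRr1 ?powR12_sqrt// ltW.
have -> : plim R k * (2 * Num.sqrt pi * (k%:R * Num.sqrt k%:R)) =
    s * (2 * k%:R) / (2 * k%:R - 1).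
  by rewrite plimE /s sqrtrM ?(ltW pi0)//; field; rewrite gt_eqF//; lra.
have d0 : 0 < 2 * k%:R - 1 :> R by lra.
rewrite ler_pdivlMr// ler_pdivrMr//.
rewrite [X in _ <= _ <= X]mulrDl mulVf ?gt_eqF// !mul1r subrK.
move: slo'; rewrite ler_pdivrMr; last by lra.
by move=> h; apply/andP; split; nra.
Qed.

Lemma plim_equiv (R : realType) : (plim R : nat -> R^o) ~_\oo
  (fun k => 1 / (2 * Num.sqrt pi * (k%:R `^ (3 / 2)))).
Proof.
apply/eqaddoP => e e0; near=> k.
have k1 : (1 <= k)%N by near: k; exact: nbhs_infty_ge.
have kr : 1 <= k%:R :> R by rewrite ler1n.
have ke : e^-1 <= k%:R by near: k; exact: nbhs_infty_ger.
have /andP[lo hi] := plim_equiv_ratio R k k1.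
rewrite /= !fctE; set g := 2 * _ * _ in lo hi *.
have g0 : 0 < g by rewrite !mulr_gt0 ?sqrtr_gt0 ?pi_gt0// powR_gt0; lra.
have d0 : 0 < 2 * k%:R - 1 :> R by lra.
have de : (2 * k%:R - 1)^-1 <= e.
  by rewrite invf_ple ?posrE//; lra.
rewrite -[X in X - _](mulfK (lt0r_neq0 g0)) -mulrBl normrM div1r.
rewrite ler_wpM2r// ger0_norm ?subr_ge0//; lra.
Unshelve. all: by end_near. Qed.

(** * Convergence in l1 *)

(** The cutoff [K] is fixed first, making the tail [2 * central_weight R K] less than [e]; then [n]
    tends to infinity, which removes the head term. *)
Lemma normalized_l1_cvg (R : realType) (c : nat -> nat -> R) :
  (forall n, (1 <= n)%N -> solves_E n (c n)) ->
  (\sum_(1 <= k <oo) `|normalized (c n) k - plim R k|%:E)%E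
    @[n --> \oo] --> 0%E.
Proof.
move=> cE.
pose d n K : R := 2 * ((1 + K%:R / (2 * n%:R)) ^+ K - 1) + 2 * central_weight R K.
have l1_le n K : (1 <= n)%N ->
    (\sum_(1 <= k <oo) `|normalized (c n) k - plim R k|%:E <= (d n K)%:E)%E.
  move=> n1; have [p0 p1 pE] := normalized_spec R n (c n) (cE n n1).
  exact: conv_solution_l1_le.
have l1_ge0 n : (0 <= \sum_(1 <= k <oo) `|normalized (c n) k - plim R k|%:E)%E.
  by apply: nneseries_ge0 => k _ _; rewrite lee_fin.
have d_cvg K : d n K @[n --> \oo] --> 2 * central_weight R K.
  have L_cvg : 1 + K%:R / (2 * n%:R) @[n --> \oo] --> (1 : R).
    rewrite -[X in _ --> X]addr0; apply: cvgD; first exact: cvg_cst.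
    (* Shifting [n] by one exhibits the harmonic sequence [1 / (n + 1)]. *)
    rewrite -[X in _ --> X](mulr0 (K%:R / 2)) -cvg_shiftS /=.
    under eq_fun do rewrite invfM mulrA.
    by apply: cvgM; [exact: cvg_cst|exact: cvg_harmonic].
  rewrite -[X in _ --> X]add0r; apply: cvgD; last exact: cvg_cst.
  rewrite -[X in _ --> X](mulr0 2) -[X in _ * X](subrr 1).
  apply: cvgM; first exact: cvg_cst.
  apply: cvgB; last exact: cvg_cst.
  rewrite -[X in _ --> X](expr1n _ K).
  exact: cvg_comp L_cvg (@exprn_continuous R K 1).
have l1_fin n : (1 <= n)%N ->
    (\sum_(1 <= k <oo) `|normalized (c n) k - plim R k|%:E)%E \is a fin_num.
  by move=> n1; rewrite ge0_fin_numE// (le_lt_trans (l1_le n 0%N n1)) ?ltry.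
apply/fine_cvgP; split.
  by near=> n; apply: l1_fin; near: n; exact: nbhs_infty_ge.
apply/cvgrPdist_lt => e e0.
have [K _ hK] : \forall K \near \oo, `|0 - central_weight R K| < e / 2.
  by have /cvgrPdist_lt := central_weight_cvg0 R; apply; rewrite divr_gt0.
have {}hK : 2 * central_weight R K < e.
  have := hK K (leqnn K).
  by rewrite /= sub0r normrN ger0_norm ?(ltW (central_weight_gt0 R K))//; lra.
near=> n; have n1 : (1 <= n)%N by near: n; exact: nbhs_infty_ge.
rewrite sub0r normrN ger0_norm ?fine_ge0//= -lte_fin fineK ?l1_fin//.
rewrite (le_lt_trans (l1_le n K n1))// lte_fin; near: n.
exact: (cvgr_lt _ (d_cvg K)).
Unshelve. all: by end_near. Qed.

Theorem theorem3 (R : realType) :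
  [/\ (forall c : nat -> nat -> R,
         (forall n, (1 <= n)%N -> solves_E n (c n)) ->
         (\sum_(1 <= k <oo) `|normalized (c n) k - plim R k|%:E)%E
           @[n --> \oo] --> 0%E),
      solves_limit_eq (plim R),
      (forall q : nat -> R, solves_limit_eq q ->
         forall k, (1 <= k)%N -> q k = plim R k)
    & (plim R : nat -> R^o) ~_\oo
        (fun k => 1 / (2 * Num.sqrt pi * (k%:R `^ (3 / 2))))].
Proof.
split.
- exact: normalized_l1_cvg.
- exact: solves_limit_eq_plim.
- exact: solves_limit_eq_unique.
- exact: plim_equiv.
Qed.
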